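(* Let $d\ge 2$ and let $\mathbf{n}=(n_1,\dots,n_d)$ be a $d$-dimensional shape. Then, for any dimer configuration $D$ on $\mathbb{Q}_\mathbf{n}^d$, there exists $\mathbf{x}\in\mathbb{Z}^d$ such that the unit cube $\mathbf{x}+\mathbb{Q}^d\subseteq\mathbb{Q}_\mathbf{n}^d$ contains at least $2^{d-2}+1$ dimers of $D$ (i.e. at least $2^{d-2}+1$ dimers of $D$ have both endpoints in $\mathbf{x}+\mathbb{Q}^d$).
   Context: A dimer configuration on a graph $G$ is a perfect matching of $G$; its edges are called dimers. For a positive integer $n$, $[n]=\{1,\dots,n\}$. A $d$-dimensional shape is a vector $\mathbf{n}=(n_1,\dots,n_d)$ of integers with $n_1,\dots,n_d\ge 2$ and $n_1\cdots n_d$ even. The box $\mathbb{Q}^d_\mathbf{n}$ is the graph with vertex set $\prod_{i=1}^d[n_i]$, where $\mathbf{u},\mathbf{v}$ are adjacent if there is $i\in[d]$ with $u_j=v_j$ for all $j\ne i$ and $|u_i-v_i|=1$. $\mathbb{Q}^d$ denotes $\mathbb{Q}^d_{(2,\dots,2)}$, the unit hypercube with vertex set $[2]^d$, and $\mathbf{x}+\mathbb{Q}^d$ is its translate by $\mathbf{x}$ (as an induced subgraph of $\mathbb{Q}^d_\mathbf{n}$). *)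

(* Defs.v *)
From HB Require Import structures.
From mathcomp Require Import all_boot all_order all_algebra.

Set Implicit Arguments.
Unset Strict Implicit.
Unset Printing Implicit Defensive.

Import Order.TTheory GRing.Theory Num.Theory.

Local Open Scope ring_scope.

Definition edges (T : finType) (adj : rel T) : {set {set T}} :=
  [set [set p.1; p.2] | p in [pred p : T * T | adj p.1 p.2]].

Definition perfect_matching (T : finType) (adj : rel T)
    (D : {set {set T}}) : bool :=
  (D \subset edges adj) && [forall v : T, #|[set e in D | v \in e]| == 1%N].

Definition is_shape (d : nat) (n : 'I_d -> nat) : bool :=
  [forall i, (2 <= n i)%N] && ~~ odd (\prod_i n i)%N.

(* The integer points of [n_1] x ... x [n_d]. *)
Definition in_box (d : nat) (n : 'I_d -> nat) (p : 'rV[int]_d) : bool :=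
  [forall i, 1 <= p 0 i <= (n i)%:Z].

(* The same points as a finite type: ['I_(n i)] starts at 0 whereas [n_i]
   starts at 1, so the point denoted by a vertex is given by [pos]. *)
Definition box (d : nat) (n : 'I_d -> nat) : finType :=
  {dffun forall i : 'I_d, 'I_(n i)}.

Definition pos (d : nat) (n : 'I_d -> nat) (v : box n) : 'rV[int]_d :=
  \row_i (v i).+1%:Z.

Lemma pos_inj (d : nat) (n : 'I_d -> nat) : injective (@pos d n).
Proof.
move=> u v /rowP uv; apply/ffunP => i; apply: val_inj.
by have := uv i; rewrite !mxE => -[].
Qed.

Lemma in_boxP (d : nat) (n : 'I_d -> nat) (p : 'rV[int]_d) :
  reflect (exists v : box n, pos v = p) (in_box n p).
Proof.
apply: (iffP forallP) => [pn | [v <-] i]; last by rewrite mxE !lez_nat /=.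
have ltp i : (`|p 0%R i|.-1 < n i)%N.
  by move: (pn i); case: (p 0 i) => [[|k]|k] //= /andP[].
exists [ffun i => Ordinal (ltp i)]; apply/rowP => i; rewrite mxE ffunE /=.
by move: (pn i); case: (p 0 i) => [[|k]|k] //= /andP[].
Qed.

Definition box_adj (d : nat) (n : 'I_d -> nat) : rel (box n) := fun u v =>
  [exists i, [forall (j | j != i), pos u 0 j == pos v 0 j]
             && (`|pos u 0 i - pos v 0 i| == 1)].

(* The vertex set of x + Q^d. *)
Definition in_unit_cube (d : nat) (x p : 'rV[int]_d) : bool :=
  in_box (fun=> 2%N) (p - x).

Definition dimers_in_cube (d : nat) (n : 'I_d -> nat) (D : {set {set box n}})
    (x : 'rV[int]_d) : {set {set box n}} :=
  [set e in D | [forall (v | v \in e), in_unit_cube x (pos v)]].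

(* Main.v *)
Require Import Defs.
From HB Require Import structures.
From mathcomp Require Import all_boot all_order all_algebra.
From mathcomp Require Import zify.

(** Give the cube [x + Q^d] the weight [\prod_i x_i' * (n_i - x_i')], where
    [x_i' = x_i + 1].  Every factor vanishes at [0] and [n_i], so cubes that
    leave the box have weight [0], and it is strictly concave.  Let [W v]
    (resp. [W e]) be the total weight of the cubes containing a vertex [v]
    (resp. a dimer [e]).  For a dimer [e = uv] in direction [i], strict
    concavity in the [i]-th coordinate is exactly [W u + W v < 4 * W e].
    Summing over [D], whose dimers cover every vertex once, the weighted number
    of vertices in a cube is less than four times its weighted number of dimers.
    A cube of positive weight has [2^d] vertices, so some such cube has more
    than [2^d / 4] dimers. *)

Import Order.TTheory GRing.Theory Num.Theory.

Lemma sum_indicator_eq {N u : nat} (F : nat -> nat) :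
  u < N -> \sum_(k < N) F k * (k == u :> nat) = F u.
Proof.
move=> ltuN; rewrite (bigD1 (Ordinal ltuN)) //= eqxx muln1 big1 ?addn0 //.
by move=> k; rewrite -val_eqE /= => /negPf ->; rewrite muln0.
Qed.

(** Turns membership in a cube into a product over coordinates, so that sums over cubes factor. *)
Lemma nat_forallE {I : finType} (P : pred I) :
  [forall i, P i] = \prod_i (P i : nat) :> nat.
Proof.
case: forallP => [allP | nallP]; first by rewrite big1 // => i _; rewrite allP.
have /existsP[i nPi] : [exists i, ~~ P i].
  by rewrite -negb_forall; apply/negP => /forallP.
by rewrite (bigD1 i) //= (negPf nPi).
Qed.

Definition parabola (m k : nat) : nat := k * (m - k).

Lemma parabola_gt0 {m k : nat} : 0 < k -> k < m -> 0 < parabola m k.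
Proof. by rewrite /parabola muln_gt0 subn_gt0 => -> ->. Qed.

Lemma parabola_strictly_concave {m u : nat} :
  u.+1 < m -> parabola m u + parabola m u.+2 < 2 * parabola m u.+1.
Proof. by move=> /subnKC <-; rewrite /parabola; nia. Qed.

Lemma sum_parabola_vertex {N : nat} (m : nat) {u : nat} : u < N ->
  \sum_(k < N) parabola m k.+1 * (k <= u <= k.+1)
    = parabola m u + parabola m u.+1.
Proof.
move=> ltuN.
rewrite (eq_bigr (fun k : 'I_N => parabola m k.+1 * (k.+1 == u)
                                  + parabola m k.+1 * (k == u :> nat))).
  rewrite big_split /= (sum_indicator_eq (fun k => parabola m k.+1)) //.
  (* No interval ends at [u = 0], which agrees with [parabola m 0 = 0]. *)
  congr (_ + _); case: u ltuN => [|u] ltuN.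
    by rewrite big1 // => k _; rewrite muln0.
  exact: (sum_indicator_eq (fun k => parabola m k.+1) (ltnW ltuN)).
by move=> k _; rewrite -mulnDr; congr (_ * _); lia.
Qed.

Lemma sum_parabola_edge {N : nat} (m : nat) {u : nat} : u < N ->
  \sum_(k < N) parabola m k.+1 * ((k <= u <= k.+1) && (k <= u.+1 <= k.+1))
    = parabola m u.+1.
Proof.
move=> ltuN; rewrite -[RHS](sum_indicator_eq (fun k => parabola m k.+1) ltuN).
by apply: eq_bigr => k _; congr (_ * _); lia.
Qed.

Section Cubes.

Context {d : nat} {n : 'I_d -> nat}.

Let N := \max_i n i.

Lemma ltn_box_max (v : box n) i : v i < N.
Proof. exact: leq_trans (ltn_ord _) (leq_bigmax i). Qed.

(* Cubes are indexed by a non-dependent type so that sums of products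
   distribute; those that leave the box have weight [0] because of the
   truncated subtraction in [parabola]. *)
Definition cube := {ffun 'I_d -> 'I_N}.

Implicit Types (f : cube) (u v : box n).

(** The translation [x]: since [[2]] starts at 1, the lowest point of the cube is one more in each
    coordinate. *)
Definition corner f : 'rV[int]_d := (\row_i (f i : nat)%:Z)%R.

Definition weight f : nat := \prod_i parabola (n i) (f i).+1.

Definition vertex_weight v : nat :=
  \sum_f weight f * in_unit_cube (corner f) (pos v).

Definition edge_weight (e : {set box n}) : nat :=
  \sum_f weight f * [forall (v | v \in e), in_unit_cube (corner f) (pos v)].

Lemma in_unit_cube_corner f v :
  in_unit_cube (corner f) (pos v) = [forall i, f i <= v i <= (f i).+1].
Proof. by apply: eq_forallb => i; rewrite !mxE; lia. Qed.

Lemma weight_gt0P {f} : 0 < weight f -> forall i, (f i).+1 < n i.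
Proof.
rewrite /weight => w_gt0 i; move: w_gt0.
by rewrite (bigD1 i) //= !muln_gt0 subn_gt0 => /andP[/andP[]].
Qed.

(** Weight and membership are both products over coordinates, so distributivity leaves
    one-dimensional sums. *)
Lemma vertex_weightE v :
  vertex_weight v = \prod_i (parabola (n i) (v i) + parabola (n i) (v i).+1).
Proof.
under [RHS]eq_bigr => i _ do
  rewrite -(sum_parabola_vertex (n i) (ltn_box_max v i)).
rewrite bigA_distr_bigA; apply: eq_bigr => f _ /=.
by rewrite in_unit_cube_corner nat_forallE -big_split.
Qed.

Lemma edge_weightE u v :
  edge_weight [set u; v] =
  \prod_i \sum_(k < N) parabola (n i) k.+1
                       * ((k <= u i <= k.+1) && (k <= v i <= k.+1)).
Proof.
rewrite bigA_distr_bigA; apply: eq_bigr => f _ /=.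
rewrite big_split /= -nat_forallE; congr (_ * nat_of_bool _).
apply/forall_inP/forallP => [uvf i | uvf w].
  have := uvf u (set21 _ _); have := uvf v (set22 _ _).
  by rewrite !in_unit_cube_corner => /forallP -> /forallP ->.
by rewrite in_unit_cube_corner => /set2P[] ->; apply/forallP => i;
  case/andP: (uvf i).
Qed.

Lemma vertex_weights_lt_edge_weight {u v} {i : 'I_d} :
  (forall i, 1 < n i) ->
  (forall j, j != i -> u j = v j :> nat) -> v i = (u i).+1 :> nat ->
  vertex_weight u + vertex_weight v < 4 * edge_weight [set u; v].
Proof.
move=> n_gt1 uv vi; rewrite !vertex_weightE edge_weightE.
rewrite !(bigD1 (P := xpredT) i) //= vi.
rewrite (sum_parabola_edge _ (ltn_box_max u i)).
rewrite [X in _ + _ * X](eq_bigr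
  (fun j => parabola (n j) (u j) + parabola (n j) (u j).+1)); last first.
  by move=> j ji; rewrite uv.
rewrite [X in 4 * (_ * X)](eq_bigr
  (fun j => parabola (n j) (u j) + parabola (n j) (u j).+1)); last first.
  move=> j ji; rewrite -(sum_parabola_vertex _ (ltn_box_max u j)).
  by apply: eq_bigr => k _; rewrite -uv // andbb.
(* The directions other than [i] give the same factor [S] to all three weights. It is positive
   because [n j > 1] leaves room for a unit interval around [u j]. *)
set S := \prod_(j | _) _.
have S_gt0 : 0 < S.
  apply: prodn_cond_gt0 => j _; rewrite addn_gt0.
  case: (ltnP (u j).+1 (n j)) => [lt_un | le_nu].
    by rewrite (parabola_gt0 _ lt_un) ?orbT.
  by rewrite parabola_gt0 ?ltn_ord // -ltnS (leq_trans (n_gt1 j)).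
have := @parabola_strictly_concave (n i) (u i).
rewrite -{1}vi ltn_ord => /(_ isT) concave.
(* Here [a], [b], [c] are the parabola at [u i] and its two successors: the endpoints contribute
   [a + b] and [b + c], the dimer only [b]. *)
have four a b c : a + c < 2 * b -> a + b + (b + c) < 4 * b by lia.
by rewrite -mulnDl mulnA ltn_pmul2r // four.
Qed.

Lemma sum_vertex_weights_lt_edge_weight {e : {set box n}} :
  (forall i, 1 < n i) -> e \in edges (@box_adj d n) ->
  \sum_(v in e) vertex_weight v < 4 * edge_weight e.
Proof.
move=> n_gt1 /imsetP[[u v] /= /existsP[i /andP[/forall_inP uv d_uv] ->]].
have {}uv j : j != i -> u j = v j :> nat.
  by move=> /uv; rewrite !mxE => /eqP[].
rewrite !mxE in d_uv.
rewrite big_setU1 ?big_set1 /=; last first.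
  by apply: contraL d_uv => /set1P ->; rewrite subrr normr0.
have dist1 (a b : nat) :
    (`|a.+1%:Z - b.+1%:Z| == 1)%R -> b = a.+1 \/ a = b.+1 by lia.
have [vi | ui] := dist1 _ _ d_uv.
  exact: vertex_weights_lt_edge_weight n_gt1 uv vi.
rewrite addnC setUC; apply: vertex_weights_lt_edge_weight n_gt1 _ ui => j ji.
by rewrite uv.
Qed.

Lemma card_unit_cube {f} :
  (forall i, (f i).+1 < n i) ->
  2 ^ d <= #|[set v : box n | in_unit_cube (corner f) (pos v)]|.
Proof.
move=> f_in.
have lt_fb (b : {ffun 'I_d -> bool}) i : f i + b i < n i.
  by have := f_in i; case: (b i); lia.
(* The vertices of the cube are [f + b] for 0/1 vectors [b]. *)
pose vertex (b : {ffun 'I_d -> bool}) : box n :=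
  [ffun i => Ordinal (lt_fb b i)].
have vertex_inj : injective vertex.
  move=> b c /ffunP bc; apply/ffunP => i; have := congr1 val (bc i).
  by rewrite !ffunE /= => /addnI; case: (b i) (c i) => [] [].
have <- : #|[set vertex b | b in predT]| = 2 ^ d.
  by rewrite card_imset // card_ffun card_bool card_ord.
apply/subset_leq_card/subsetP => _ /imsetP[b _ ->].
rewrite inE in_unit_cube_corner; apply/forallP => i; rewrite ffunE /=.
by case: (b i); lia.
Qed.

(** Double counting of cubes and their vertices; cubes that leave the box have weight 0. *)
Lemma sum_vertex_weight_ge :
  (\sum_f weight f) * 2 ^ d <= \sum_(v : box n) vertex_weight v.
Proof.
rewrite exchange_big big_distrl; apply: leq_sum => f _ /=.
rewrite -big_distrr /=; case: (posnP (weight f)) => [-> //|w_gt0].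
rewrite leq_pmul2l //; apply: leq_trans (card_unit_cube (weight_gt0P w_gt0)) _.
rewrite -sum1_card big_mkcond leq_sum // => v _.
by rewrite inE; case: (in_unit_cube _ _).
Qed.

Lemma sum_edge_weight (D : {set {set box n}}) :
  \sum_(e in D) edge_weight e
    = \sum_f weight f * #|dimers_in_cube D (corner f)|.
Proof.
rewrite exchange_big; apply: eq_bigr => f _ /=.
rewrite -big_distrr /= -sum1_card big_mkcond [in RHS]big_mkcond /=.
congr (_ * _); apply: eq_bigr => e _; rewrite inE.
by case: (e \in D) => //=; case: [forall _, _].
Qed.

(** Each vertex lies in exactly one dimer, so exchanging the sums counts [F v] once. *)
Lemma sum_perfect_matching {adj : rel (box n)} {D} (F : box n -> nat) :
  perfect_matching adj D -> \sum_(e in D) \sum_(v in e) F v = \sum_v F v.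
Proof.
case/andP=> _ /forallP matched.
rewrite (exchange_big_dep xpredT) //=; apply: eq_bigr => v _.
rewrite sum_nat_const -[RHS]mul1n -(eqP (matched v)); congr (_ * _).
by apply: eq_card => e; rewrite !inE.
Qed.

Lemma weighted_dimers_gt {D} :
  (forall i, 1 < n i) -> perfect_matching (@box_adj d n) D ->
  (\sum_f weight f) * 2 ^ d
    < 4 * \sum_f weight f * #|dimers_in_cube D (corner f)|.
Proof.
move=> n_gt1 matchD; have [/subsetP D_edges /forallP matched] := andP matchD.
apply: leq_ltn_trans sum_vertex_weight_ge _.
rewrite -(sum_perfect_matching _ matchD) -sum_edge_weight big_distrr /=.
(* The summed inequality is strict only if [D] is nonempty; some dimer covers [v0]. *)
pose v0 : box n := [ffun i => Ordinal (ltnW (n_gt1 i))].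
have D_gt0 : 0 < #|D|.
  rewrite -[X in X <= _](eqP (matched v0)) subset_leq_card //.
  by apply/subsetP => e; rewrite inE => /andP[].
(* Each dimer gains at least 1, so the total gain is at least [#|D|]. *)
rewrite -addn1; apply: leq_trans (leq_add (leqnn _) D_gt0) _.
rewrite -sum1_card -big_split /=; apply: leq_sum => e eD.
by rewrite addn1 sum_vertex_weights_lt_edge_weight // D_edges.
Qed.

Lemma in_box_unit_cube {f} {p : 'rV[int]_d} :
  (forall i, (f i).+1 < n i) -> in_unit_cube (corner f) p -> in_box n p.
Proof.
move=> f_in /forallP p_in; apply/forallP => i.
have := p_in i; have := f_in i; rewrite !mxE.
by move: (p _ i) (nat_of_ord (f i)) (n i) => pi k m; lia.
Qed.

End Cubes.

Theorem theorem1p3 (d : nat) (n : 'I_d -> nat) (D : {set {set box n}}) :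
  (2 <= d)%N ->
  is_shape n ->
  perfect_matching (@box_adj d n) D ->
  exists x : 'rV[int]_d,
    (forall p : 'rV[int]_d, in_unit_cube x p -> in_box n p) /\
    (2 ^ (d - 2) + 1 <= #|dimers_in_cube D x|)%N.
Proof.
move=> d_ge2 /andP[/forallP n_gt1 _] /(weighted_dimers_gt n_gt1) many.
have [f w_gt0 f_many] : exists2 f : @cube d n,
    0 < weight f & 2 ^ (d - 2) < #|dimers_in_cube D (corner f)|.
  (* If every cube of positive weight had at most [2 ^ (d - 2)] dimers, the right side of [many]
     would be at most [4 * 2 ^ (d - 2) = 2 ^ d] times the total weight. *)
  apply/exists_inP; apply: contraLR many; rewrite negb_exists => /forallP few.
  rewrite -leqNgt -[in 2 ^ d](subnK d_ge2) expnD mulnA [leqRHS]mulnC.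
  rewrite leq_mul // big_distrl; apply: leq_sum => f _ /=.
  have := few f; rewrite negb_and -leqNgt leqn0 -leqNgt.
  by case/orP => [/eqP -> // | few_f]; rewrite leq_mul2l few_f orbT.
exists (corner f); split; last by rewrite addn1.
by move=> p; apply/in_box_unit_cube/weight_gt0P.
Qed.
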